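(* Let $\mathbb{S}$ be a finite set equipped with a fully supported probability law $\nu$, let $n\ge1$ be an integer, let $\{c(i,j)\colon 1\le i\neq j\le n\}$ be a non-negative symmetric array and $\{r(i)\colon1\le i\le n\}$ a non-negative vector. Assume that the support of $r$ intersects each connected component of the graph on $[n]$ induced by the support of $c$. Let $L$ be the generator of the Colored Exclusion Process on $\mathcal{X}=\mathbb{S}^n$, acting on $f\colon\mathcal{X}\to\mathbb{R}$ by $$Lf(x):=\sum_{1\le i<j\le n}c(i,j)\left(f(x^{i\leftrightarrow j})-f(x)\right)+\sum_{1\le i\le n}r(i)\sum_{\sigma\in\mathbb{S}}\nu(\sigma)\left(f(x^{i,\sigma})-f(x)\right),$$ and let $\pi=\nu^{\otimes n}$ be the product law on $\mathcal{X}$. Then for any $\mu\in\mathcal{P}(\mathcal{X})$ and any $t\ge0$, the transition matrix $P_t:=e^{tL}$ satisfies $$H(\mu P_t\,|\,\pi)\le H(\mu\,|\,\pi)\max_{1\le i\le n}\mathbb{P}_i(T>t),$$ where $\mathbb{P}_i(T>t)$ is the probability that the life-time $T$ exceeds $t$ for a random walk on $[n]$ started from site $i$, which jumps from each site $k$ to each site $j\ne k$ at rate $c(k,j)$ and is killed at rate $r(k)$ when at site $k$.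
   Context: $[n]=\{1,\ldots,n\}$. $x^{i\leftrightarrow j}$ is the configuration obtained from $x$ by swapping the $i$-th and $j$-th entries, and $x^{i,\sigma}$ is obtained from $x$ by replacing the $i$-th entry with $\sigma$. $\mathcal{P}(\mathcal{X})$ is the set of probability measures on $\mathcal{X}$, and $H(\mu\,|\,\pi):=\sum_x\mu(x)\log(\mu(x)/\pi(x))$ is the relative entropy (with $0\log0=0$). Equivalently, the killed walk is governed by the Laplace matrix $\Delta(i,j)=c(i,j)$ for $i\neq j$, $\Delta(i,i)=-r(i)-\sum_{k\neq i}c(i,k)$, so that $\mathbb{P}_i(T>t)=\sum_j(e^{t\Delta})(i,j)$. *)

(* Defs.v *)
From mathcomp Require Import all_boot all_order all_algebra all_fingroup.
From mathcomp Require Import all_classical all_reals all_analysis.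
Set Implicit Arguments.
Unset Strict Implicit.
Unset Printing Implicit Defensive.
Import Order.TTheory GRing.Theory Num.Theory.
Import numFieldNormedType.Exports.
Local Open Scope classical_set_scope.
Local Open Scope ring_scope.

Definition is_law (R : realType) (E : finType) (p : E -> R) : Prop :=
  (forall x, 0 <= p x) /\ \sum_x p x = 1.

(* No convention is needed for 0 log 0 : the factor mu x vanishes and ln is
   total.  Only used with pi x > 0 for all x. *)
Definition relative_entropy (R : realType) (E : finType) (mu pi : E -> R) : R :=
  \sum_x mu x * ln (mu x / pi x).

(* Operators on functions E -> R stand for matrices indexed by E, the (x, y)
   entry of A being (A 1_{y}) x.  Hence exp_mx t A x y is the (x, y) entry of
   e^{tA}, i.e. the sum over k of t^k / k! times the (x, y) entry of A^k. *)
Definition exp_mx (R : realType) (E : finType) (t : R)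
    (A : (E -> R) -> (E -> R)) (x y : E) : R :=
  limn (series (fun k : nat =>
    t ^+ k / k`!%:R * iter k A (fun z : E => (z == y)%:R) x)).

Definition mul_law_mx (R : realType) (E : finType) (mu : E -> R)
    (P : E -> E -> R) (y : E) : R := \sum_x mu x * P x y.

Section ColoredExclusion.
Variables (R : realType) (S : finType) (n : nat).
Implicit Types (x : {ffun 'I_n -> S}) (i j : 'I_n).

Definition swap x i j : {ffun 'I_n -> S} := [ffun k => x (tperm i j k)].

Definition replace x i (s : S) : {ffun 'I_n -> S} :=
  [ffun k => if k == i then s else x k].

Definition CEP_generator (nu : S -> R) (c : 'I_n -> 'I_n -> R) (r : 'I_n -> R)
    (f : {ffun 'I_n -> S} -> R) (x : {ffun 'I_n -> S}) : R :=
  \sum_(i < n) \sum_(j < n | (i < j)%N) c i j * (f (swap x i j) - f x)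
  + \sum_(i < n) r i * \sum_(s : S) nu s * (f (replace x i s) - f x).

Definition product_law (nu : S -> R) (x : {ffun 'I_n -> S}) : R :=
  \prod_(i < n) nu (x i).

End ColoredExclusion.

Definition conductance_graph (R : realType) (n : nat) (c : 'I_n -> 'I_n -> R) :
  rel 'I_n := fun i j => (i != j) && (c i j != 0).

(* The diagonal entries q x x play no role, as f x - f x = 0. *)
Definition jump_generator (R : realType) (E : finType) (q : E -> E -> R)
    (f : E -> R) (x : E) : R := \sum_y q x y * (f y - f x).

(* The killed walk lives on option 'I_n, with None as its cemetery. *)
Definition killed_rates (R : realType) (n : nat) (c : 'I_n -> 'I_n -> R)
    (r : 'I_n -> R) (x y : option 'I_n) : R :=
  match x, y with
  | Some k, Some j => c k j
  | Some k, None => r k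
  | None, _ => 0
  end.

(* X, defined on the probability space (Omega, P), is the continuous-time
   Markov chain started from i whose jump rates are killed_rates c r : its
   paths are right-continuous for the discrete topology, stay in the cemetery
   once killed, and its finite-dimensional laws are those of the transition
   semigroup generated by the rates (k = 0 gives P (X_0 = i) = 1).  Only
   nonnegative times are constrained. *)
Record killed_random_walk (R : realType) (n : nat) (c : 'I_n -> 'I_n -> R)
    (r : 'I_n -> R) (d : measure_display) (Omega : measurableType d)
    (P : probability Omega R) (i : 'I_n) (X : R -> Omega -> option 'I_n) :
    Prop := KilledRandomWalk {
  krw_measurable : forall (t : R) (a : option 'I_n), 0 <= t ->
    measurable [set w | X t w = a] ;
  krw_right_continuous : forall (t : R) (w : Omega), 0 <= t ->
    \forall s \near t^'+, X s w = X t w ;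
  krw_absorbed : forall (s t : R) (w : Omega), 0 <= s -> s <= t ->
    X s w = None -> X t w = None ;
  krw_law : forall (k : nat) (t : nat -> R) (a : nat -> option 'I_n),
    t 0%N = 0 -> (forall l, t l <= t l.+1) -> a 0%N = Some i ->
    P [set w | forall l, (l <= k)%N -> X (t l) w = a l] =
    (\prod_(l < k) exp_mx (t l.+1 - t l)
       (jump_generator (killed_rates c r)) (a l) (a l.+1))%:E }.

(* The first hitting time of the cemetery, +oo if it is never hit. *)
Definition lifetime (R : realType) (n : nat) (Omega : Type)
    (X : R -> Omega -> option 'I_n) (w : Omega) : \bar R :=
  ereal_inf [set t%:E | t in [set t : R | 0 <= t /\ X t w = None]].

(* Main.v *)
Require Import Defs.
From mathcomp Require Import all_boot all_order all_algebra all_fingroup.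
From mathcomp Require Import all_classical all_reals all_analysis.
From mathcomp Require Import ring lra.
Set Implicit Arguments.
Unset Strict Implicit.
Unset Printing Implicit Defensive.
Import Order.TTheory GRing.Theory Num.Theory.
Import numFieldNormedType.Exports.
Local Open Scope classical_set_scope.
Local Open Scope ring_scope.

(* Let g be the density of mu with respect to pi, and split its entropy by the
   chain rule along the sites, revealed in order: H(mu | pi) is a sum of
   nonnegative increments, one per coordinate of g.  Resampling a coordinate j
   erases the increment of j and, by convexity (an averaging over j commutes
   with the conditioning), does not increase the others; permuting the sites
   only moves the increments around.  A small Euler step I + eps L is a convex
   combination of swaps, resamplings and the identity, so, by Jensen, under
   (I + eps L)^k the increment attached to a site is multiplied at most by the
   probability that the discretized killed walk started from this site is still
   alive.  Taking eps = t / m, k = m and m -> oo gives the exponentials. *)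

(** * Exponentials as limits of Euler schemes *)

Lemma cvg_sumr (R : realType) (I : Type) (s : seq I) (u : I -> R^nat)
    (l : I -> R) :
  (forall i, u i @ \oo --> l i) ->
  \sum_(i <- s) u i m @[m --> \oo] --> \sum_(i <- s) l i.
Proof. by move=> ul; apply: cvg_big => [|i _]; [exact: add_continuous|]. Qed.

(** The ratio is the product of the factors [1 - l/m] over [l < k], and its deficit from 1 is at
    most the sum of the [l/m]. It compares ['C(m, k) / m^k] with [1 / k!]. *)
Lemma ffact_ratio_bounds (R : realType) (m k : nat) : (0 < m)%N ->
  1 - k%:R ^+ 2 / m%:R <= ((m ^_ k)%:R / m%:R ^+ k : R) <= 1.
Proof.
move=> m0; have mr : 0 < m%:R :> R by rewrite ltr0n.
elim: k => [|k /andP[IH1 IH2]].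
  by rewrite ffactn0 expr0n/= !mul0r !divr1 subr0 !lexx.
set p := (m ^_ k)%:R / _ in IH1 IH2; have p0 : 0 <= p by rewrite divr_ge0.
(* The subtraction is truncated: for [m <= k] the factor is 0, which is still at least [1 - k/m]. *)
set q : R := (m - k)%:R / m%:R.
have -> : (m ^_ k.+1)%:R / m%:R ^+ k.+1 = p * q.
  by rewrite ffactnSr natrM exprSr -mulf_div.
have q0 : 0 <= q by rewrite divr_ge0.
have q1 : q <= 1 by rewrite ler_pdivrMr// mul1r ler_nat leq_subr.
have qk : 1 - k%:R / m%:R <= q.
  rewrite -[X in X - _](divff (lt0r_neq0 mr)) -mulrBl ler_pM2r ?invr_gt0//.
  by rewrite lerBlDr -natrD ler_nat addnC -leq_subLR.
apply/andP; split; last by rewrite mulr_ile1.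
have kk : (k.+1%:R : R) ^+ 2 / m%:R =
    k%:R ^+ 2 / m%:R + k%:R / m%:R + k.+1%:R / m%:R.
  by rewrite -!mulrDl -natr1; congr (_ / _); ring.
have : 0 <= k.+1%:R / m%:R :> R by rewrite divr_ge0.
have : 0 <= k%:R / m%:R :> R by rewrite divr_ge0.
have : 0 <= (1 - p) * (1 - q) by rewrite mulr_ge0 ?subr_ge0.
have : (1 - p) * (1 - q) = 1 - p - q + p * q by ring.
rewrite kk; lra.
Qed.

Section EulerScheme.
Variable R : realType.

Section Scalar.
Variables (t M C : R) (u : R^nat).
Hypotheses (t_ge0 : 0 <= t) (M_ge0 : 0 <= M) (C_ge0 : 0 <= C).
Hypothesis u_le : forall k, `|u k| <= C * M ^+ k.

Let v k := t ^+ k / k`!%:R * u k.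

Let v_le k : `|v k| <= C * exp_coeff (t * M) k.
Proof.

rewrite /v /exp_coeff/= normrM ger0_norm ?divr_ge0 ?exprn_ge0//.
have -> : C * ((t * M) ^+ k / k`!%:R) = t ^+ k / k`!%:R * (C * M ^+ k).
  by rewrite exprMn; ring.
by rewrite ler_wpM2l// divr_ge0 ?exprn_ge0.
Qed.

Lemma is_cvg_exp_series : cvgn (series v).
Proof.
apply: normed_cvg.
apply: (@series_le_cvg _ _ (fun k => C * exp_coeff (t * M) k)) => [k|k|k|].
- exact: normr_ge0.
- by rewrite mulr_ge0// /exp_coeff/= divr_ge0 ?exprn_ge0 ?mulr_ge0.

- exact: v_le.
- exact: (@is_cvg_seriesZ _ _ C (is_cvg_series_exp_coeff _)).
Qed.

(** The [k]-th term is that of the exponential series times the ratio of [ffact_ratio_bounds], so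
    the distance to the partial series is [O(1/m)]. *)
Lemma cvg_euler_scalar :
  \sum_(k < m.+1) 'C(m, k)%:R * (t / m%:R) ^+ k * u k @[m --> \oo] -->
  limn (series v).
Proof.
set s := fun m : nat => \sum_(k < m.+1) 'C(m, k)%:R * (t / m%:R) ^+ k * u k.
(* The 4 absorbs the error factor [k^2], through [k^2 <= 4^k]. *)
pose B := C * expR (t * (4 * M)).
have sv m : (0 < m)%N -> `|series v m.+1 - s m| <= B * m%:R^-1.
  move=> m0; rewrite seriesEord/= /s -sumrB.
  have mr : m%:R != 0 :> R by rewrite pnatr_eq0 -lt0n.
  apply: le_trans (ler_norm_sum _ _ _) _.
  apply: (@le_trans _ _
      (\sum_(k < m.+1) C * m%:R^-1 * exp_coeff (t * (4 * M)) k)).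
    apply: ler_sum => k _.
    have -> : 'C(m, k)%:R * (t / m%:R) ^+ k * u k =
        (m ^_ k)%:R / m%:R ^+ k * v k.
      rewrite /v -bin_ffact natrM expr_div_n.
      have : k`!%:R != 0 :> R by rewrite pnatr_eq0 -lt0n fact_gt0.
      have : m%:R ^+ k != 0 :> R by rewrite expf_neq0.
      by move=> ? ?; field; apply/andP.
    rewrite -[X in `|X - _|]mul1r -mulrBl normrM.
    have /andP[r1 r2] := ffact_ratio_bounds R k m0.
    rewrite ger0_norm ?subr_ge0//.
    apply: (@le_trans _ _ (4 ^+ k / m%:R * (C * exp_coeff (t * M) k))).
      apply: ler_pM => //; first by rewrite subr_ge0.
      rewrite (@le_trans _ _ (k%:R ^+ 2 / m%:R))//; first by lra.
      rewrite ler_pM2r ?invr_gt0 ?ltr0n// -natrX -natrX ler_nat.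
      rewrite -[4%N]/(2 ^ 2)%N -expnM mulnC expnM leq_exp2r//.
      by rewrite ltnW// ltn_expl.
    rewrite le_eqVlt; apply/orP; left; apply/eqP.
    by rewrite /exp_coeff/= !exprMn; ring.
  rewrite -mulr_sumr /B -[leRHS]mulrAC ler_wpM2l//.
    by rewrite mulr_ge0// invr_ge0.
  rewrite (_ : bigop _ _ _ = series (exp_coeff (t * (4 * M))) m.+1); last first.
    by rewrite seriesEord.
  apply: nondecreasing_cvgn_le; last exact: is_cvg_series_exp_coeff.
  apply: nondecreasing_series => k _ _ /=.
  by rewrite divr_ge0// exprn_ge0// !mulr_ge0.
have h : (series v m.+1 - s m) @[m --> \oo] --> 0.
  apply: norm_cvg0.
  apply: (@squeeze_cvgr _ _ _ _ (fun=> 0) (fun m : nat => B * m%:R^-1)).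
  - near=> m; rewrite normr_ge0/= sv//; near: m; exact: nbhs_infty_gt.
  - exact: cvg_cst.
  - rewrite -(mulr0 B); apply: cvgMr; rewrite -cvg_shiftS; exact: cvg_harmonic.
have -> : s = (fun m => series v m.+1 - (series v m.+1 - s m)).
  by apply/funext => m; rewrite opprB addrC subrK.
rewrite -[X in _ --> X]subr0; apply: cvgB h.
by rewrite cvg_shiftS; exact: is_cvg_exp_series.
Unshelve. all: by end_near. Qed.

End Scalar.

(** * Linear operators on a finite set and their exponentials *)

Definition linear_op (E : Type) (A : (E -> R) -> E -> R) : Prop :=
  forall a f g x, A (fun z => a * f z + g z) x = a * A f x + A g x.

Section LinearOp.
Variables (E : finType) (A : (E -> R) -> E -> R).
Hypothesis A_lin : linear_op A.

Lemma linear_op0 x : A (fun=> 0) x = 0.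
Proof.
have := A_lin (-1) (fun=> 0) (fun=> 0) x.
by rewrite mulr0 addr0 mulN1r addNr.
Qed.

Lemma linear_op_sum (I : Type) (s : seq I) (a : I -> R) (g : I -> E -> R) x :
  A (fun z => \sum_(i <- s) a i * g i z) x = \sum_(i <- s) a i * A (g i) x.
Proof.
elim: s => [|i s IH].
  under eq_fun do rewrite big_nil.
  by rewrite big_nil linear_op0.
by under eq_fun do rewrite big_cons; rewrite A_lin IH big_cons.
Qed.

Lemma linear_op_indic f x :
  A f x = \sum_y f y * A (fun z => (z == y)%:R) x.
Proof.
rewrite -linear_op_sum; congr (A _ x); apply/funext => z.
rewrite (bigD1 z)//= eqxx mulr1 big1 ?addr0// => y /negPf.
by rewrite eq_sym => ->; rewrite mulr0.
Qed.

Lemma linear_op_iter k : linear_op (iter k A).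
Proof.
elim: k => [//|k IH] a f g x /=.
rewrite -A_lin; congr (A _ x); apply/funext => z; exact: IH.
Qed.

End LinearOp.

Section OperatorExponential.
Variables (E : finType) (A : (E -> R) -> E -> R).
Hypothesis A_lin : linear_op A.

(** With [M] the sum of the absolute values of all matrix entries, each application of [A]
    multiplies the l1 norm by at most [M]. *)
Lemma linear_op_bound : exists2 M, 0 <= M &
  forall f k x, `|iter k A f x| <= (\sum_y `|f y|) * M ^+ k.
Proof.
pose M := \sum_x \sum_y `|A (fun z => (z == y)%:R) x|.
have M0 : 0 <= M by apply: sumr_ge0 => x _; apply: sumr_ge0.
exists M => // f k x.
have step g : \sum_x `|A g x| <= (\sum_y `|g y|) * M.
  rewrite /M mulr_sumr; apply: ler_sum => z _.
  rewrite (linear_op_indic A_lin); apply: le_trans (ler_norm_sum _ _ _) _.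
  rewrite mulr_sumr; apply: ler_sum => y _; rewrite normrM ler_wpM2r//.
  by rewrite (bigD1 y)//= lerDl sumr_ge0.
apply: (@le_trans _ _ (\sum_y `|iter k A f y|)).
  by rewrite (bigD1 x)//= lerDl sumr_ge0.
elim: k => [|k IH]; first by rewrite mulr1.
by rewrite iterS exprSr mulrA (le_trans (step _))// ler_wpM2r.
Qed.

Definition euler_step (eps : R) (g : E -> R) (x : E) : R :=
  g x + eps * A g x.

Lemma linear_op_euler eps : linear_op (euler_step eps).
Proof. by move=> a f g x; rewrite /euler_step A_lin; ring. Qed.

Lemma iter_euler_binomial eps f m x :
  iter m (euler_step eps) f x =
  \sum_(k < m.+1) 'C(m, k)%:R * eps ^+ k * iter k A f x.
Proof.
elim: m x => [|m IH] x; first by rewrite big_ord1 bin0 !mul1r.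
rewrite iterS /euler_step (_ : iter m _ f = fun z =>
  \sum_(k < m.+1) 'C(m, k)%:R * eps ^+ k * iter k A f z); last exact/funext.
rewrite (linear_op_sum A_lin) big_ord_recl [RHS]big_ord_recl/= !bin0 -addrA.
congr (_ + _).
rewrite mulr_sumr [X in _ + X]big_ord_recr [RHS]big_ord_recr/=.
rewrite addrA -big_split/=; congr (_ + _).
  apply: eq_bigr => k _; rewrite /bump/= add1n binS natrD exprS; ring.
by rewrite /bump/= add1n !binn exprS; ring.
Qed.

(** The binomial formula reduces this to the scalar scheme with [u k = iter k A f x]. *)
Lemma cvg_euler t f x : 0 <= t ->
  iter m (euler_step (t / m%:R)) f x @[m --> \oo] -->
  \sum_y exp_mx t A x y * f y.
Proof.
move=> t0; have [M M0 bd] := linear_op_bound.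
have C0 (g : E -> R) : 0 <= \sum_y `|g y| by exact: sumr_ge0.
have cvS (g : E -> R) := is_cvg_exp_series t0 M0 (C0 g) (bd g ^~ x).
under eq_cvg do rewrite iter_euler_binomial.
have -> : \sum_y exp_mx t A x y * f y =
    limn (series (fun k => t ^+ k / k`!%:R * iter k A f x)).
  apply/esym/cvg_lim => //.
  have -> : series (fun k => t ^+ k / k`!%:R * iter k A f x) =
      fun m => \sum_y series (fun k => t ^+ k / k`!%:R *
        iter k A (fun z => (z == y)%:R) x) m * f y.
    apply/funext => m; rewrite seriesEord/= [RHS](eq_bigr (fun y =>
      \sum_(k < m) t ^+ k / k`!%:R * iter k A (fun z => (z == y)%:R) x * f y)).
      rewrite exchange_big/=; apply: eq_bigr => k _.
      rewrite (linear_op_indic (linear_op_iter A_lin k)) mulr_sumr.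
      by apply: eq_bigr => y _; ring.
    by move=> y _; rewrite seriesEord/= mulr_suml.
  by apply: cvg_sumr => y; apply: cvgMl; apply: cvS.
exact: (cvg_euler_scalar t0 M0 (C0 f) (bd f ^~ x)).
Qed.

End OperatorExponential.
End EulerScheme.

(** * Entropy and resampling *)

(** This is [ln u <= u - 1] at [u = y / x], the source of all convexity bounds below. The last
    hypothesis excludes [y = 0 < x], where the default value [ln 0 = 0] could break the
    inequality. *)
Lemma xlnx_tangent (R : realType) (x y : R) : 0 <= x -> 0 <= y ->
  (0 < x -> 0 < y) -> x - y <= x * (ln x - ln y).
Proof.
rewrite le_eqVlt => /predU1P[<- y0 _|x0 _ /(_ x0) y0].
  by rewrite mul0r sub0r oppr_le0.
have yx : 0 < y / x by rewrite divr_gt0.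
have := @le_ln1Dx _ (y / x - 1); rewrite ltrBrDl subrr => /(_ yx).
rewrite subrKC ln_div ?posrE// -(ler_pM2l x0) !mulrBr mulr1 mulrCA.
by rewrite divff ?gt_eqF// mulr1; lra.
Qed.

Section Resampling.
Variables (R : realType) (S : finType) (n : nat) (nu : S -> R).
Hypotheses (nu_law : is_law nu) (nu_full : forall s : S, 0 < nu s).

Local Notation conf := {ffun 'I_n -> S}.
Implicit Types (f g h : conf -> R) (x y : conf) (i j : 'I_n).

Local Notation pi := (product_law nu).
Local Notation mean g := (\sum_x pi x * g x).

Lemma product_law_gt0 x : 0 < pi x.
Proof. by apply: prodr_gt0 => i _. Qed.

Lemma replace_eq x i s : replace x i s i = s.
Proof. by rewrite ffunE eqxx. Qed.

Lemma replace_id x i : replace x i (x i) = x.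
Proof. by apply/ffunP => k; rewrite ffunE; case: eqP => [->|]. Qed.

Lemma replaceK x i s u : replace (replace x i s) i u = replace x i u.
Proof. by apply/ffunP => k; rewrite !ffunE; case: eqP. Qed.

Lemma replaceC x i j s u : i != j ->
  replace (replace x i s) j u = replace (replace x j u) i s.
Proof.
move=> /negPf ij; apply/ffunP => k; rewrite !ffunE.
by case: (eqVneq k j) => [->|//]; rewrite eq_sym ij.
Qed.

(** Conditional expectation of [g] under [pi] given all coordinates except [i]. *)
Definition resample i g x := \sum_s nu s * g (replace x i s).

Lemma resample_ge0 i g : (forall x, 0 <= g x) -> forall x, 0 <= resample i g x.
Proof. by move=> g0 x; apply: sumr_ge0 => s _; rewrite mulr_ge0// ltW. Qed.

Lemma resample_gt0 i g : (forall x, 0 <= g x) ->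
  forall x, 0 < g x -> 0 < resample i g x.
Proof.
move=> g0 x gx; rewrite /resample (bigD1 (x i))//= replace_id.
by rewrite ltr_pwDl ?mulr_gt0// sumr_ge0// => s _; rewrite mulr_ge0// ltW.
Qed.

Lemma resample_replace i g x s : resample i g (replace x i s) = resample i g x.
Proof. by apply: eq_bigr => u _; rewrite replaceK. Qed.

Lemma resampleM i g h x : (forall y s, h (replace y i s) = h y) ->
  resample i (fun z => g z * h z) x = resample i g x * h x.
Proof.
by move=> hi; rewrite mulr_suml; apply: eq_bigr => s _; rewrite hi mulrA.
Qed.

Lemma resample_invariant i g : (forall y s, g (replace y i s) = g y) ->
  resample i g = g.
Proof.
move=> gi; apply/funext => x; rewrite /resample.
under eq_bigr do rewrite gi.
by rewrite -mulr_suml (proj2 nu_law) mul1r.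
Qed.

Lemma resample_idem i g : resample i (resample i g) = resample i g.
Proof. by apply: resample_invariant => y s; rewrite resample_replace. Qed.

Lemma resampleC i j g : resample i (resample j g) = resample j (resample i g).
Proof.
have [->//|ij] := eqVneq i j; apply/funext => x.
rewrite /resample; under eq_bigr do rewrite mulr_sumr.
under [RHS]eq_bigr do rewrite mulr_sumr.
rewrite exchange_big/=; apply: eq_bigr => s _; apply: eq_bigr => u _.
by rewrite replaceC// mulrCA.
Qed.

Lemma product_law_replace x i s :
  pi (replace x i s) * nu (x i) = pi x * nu s.
Proof.
rewrite /product_law (bigD1 i)//= [in RHS](bigD1 i)//= replace_eq.
rewrite [X in _ * X * _](eq_bigr (fun k => nu (x k))) => [|k ki].
  by ring.
by rewrite ffunE (negPf ki).
Qed.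

Lemma mean_resample i g : mean (resample i g) = mean g.
Proof.
transitivity (\sum_(p : conf * S) pi p.1 * nu p.2 * g (replace p.1 i p.2)).
  rewrite -(pair_bigA _ (fun x s => pi x * nu s * g (replace x i s)))/=.
  apply: eq_bigr => x _; rewrite mulr_sumr.
  by apply: eq_bigr => s _; rewrite mulrA.
(* Exchanging coordinate [i] with the fresh sample preserves their joint law. *)
pose h (p : conf * S) := (replace p.1 i p.2, p.1 i).
have hK : involutive h.
  by move=> [x s]; rewrite /h/= replaceK replace_id replace_eq.
rewrite (reindex_inj (inv_inj hK))/=.
under eq_bigr do rewrite product_law_replace replaceK replace_id.
rewrite -(pair_bigA _ (fun x s => pi x * nu s * g x))/=.
apply: eq_bigr => x _; rewrite -mulr_suml -mulr_sumr.
by rewrite (proj2 nu_law) mulr1.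
Qed.

(** Self-adjointness of a conditional expectation: both sides equal the mean of the product of
    [resample i g] and [resample i h]. *)
Lemma mean_resampleM i g h :
  mean (fun x => resample i g x * h x) = mean (fun x => g x * resample i h x).
Proof.
have sym u v : mean (fun x => resample i u x * v x) =
    mean (fun x => resample i u x * resample i v x).
  rewrite -(mean_resample i); apply: eq_bigr => x _; congr (_ * _).
  rewrite [RHS]mulrC -(@resampleM i v (resample i u)) => [|y s]; last first.
    exact: resample_replace.
  by apply: eq_bigr => s _; rewrite [u in _ * u]mulrC.
have comm u v : mean (fun x => u x * v x) = mean (fun x => v x * u x).
  by apply: eq_bigr => x _; rewrite [u x * _]mulrC.
by rewrite sym comm -sym comm.
Qed.

Definition xlnx_mean g := mean (fun x => g x * ln (g x)).
Local Notation phi := xlnx_mean.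

(** For nonnegative [g], the mean of the entropy of [g] in coordinate [i] alone, the others being
    fixed. *)
Definition site_entropy i g := phi g - phi (resample i g).
Local Notation ent := site_entropy.

Lemma site_entropyE i g :
  ent i g = mean (fun x => g x * (ln (g x) - ln (resample i g x))).
Proof.
have phiR : phi (resample i g) = mean (fun x => g x * ln (resample i g x)).
  rewrite /phi mean_resampleM; apply: eq_bigr => x _; congr (_ * (_ * _)).
  rewrite (congr1 (@^~ x) (@resample_invariant i _ _))// => y s.
  by rewrite resample_replace.
by rewrite /ent phiR /phi -sumrB; apply: eq_bigr => x _; ring.
Qed.

(* Conditional entropy of one coordinate is convex in g, and resampling
   another coordinate is an averaging commuting with the conditioning. *)
Lemma site_entropy_resample i j g : (forall x, 0 <= g x) ->
  ent i (resample j g) <= ent i g.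
Proof.
move=> g0; rewrite !site_entropyE resampleC.
set b := resample i g; set a' := resample j g; set b' := resample j b.
have b0 : forall x, 0 <= b x by exact: resample_ge0.
have a'0 : forall x, 0 <= a' x by exact: resample_ge0.
have b'0 : forall x, 0 <= b' x by exact: resample_ge0.
have gb x : 0 < g x -> 0 < b x by exact: resample_gt0.
have ga' x : 0 < g x -> 0 < a' x by exact: resample_gt0.
have ab' x : 0 < a' x -> 0 < b' x.
  by rewrite /b' /b resampleC; apply: resample_gt0.
have -> : mean (fun x => a' x * (ln (a' x) - ln (b' x))) =
    mean (fun x => g x * (ln (a' x) - ln (b' x))).
  rewrite mean_resampleM; apply: eq_bigr => x _; congr (_ * (_ * _)).
  rewrite (congr1 (@^~ x) (@resample_invariant j _ _))// => y s.
  by rewrite /a' /b' !resample_replace.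
(* [b * (a' / b')] is the comparison point of the tangent inequality: it has the mean of [g], so the
   linear terms cancel, and its logarithm combines those of [b], [a'] and [b']. *)
have mean_ratio : mean (fun x => b x * (a' x / b' x)) = mean g.
  rewrite -(mean_resample j g) -/a'.
  transitivity (mean (fun x => b x * resample j (fun x => a' x / b' x) x)).
    apply: eq_bigr => x _; congr (_ * (_ * _)).
    rewrite (congr1 (@^~ x) (@resample_invariant j _ _))// => y s.
    by rewrite /a' /b' !resample_replace.
  rewrite -mean_resampleM -/b'; apply: eq_bigr => x _; congr (_ * _).
  have := a'0 x; rewrite le_eqVlt => /predU1P[<-|/ab' b'x].
    by rewrite mul0r mulr0.
  by rewrite mulrCA divff ?mulr1// gt_eqF.
rewrite -subr_ge0 -sumrB.
apply: (@le_trans _ _ (mean g - mean (fun x => b x * (a' x / b' x)))).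
  by rewrite mean_ratio subrr.
rewrite -sumrB; apply: ler_sum => x _; rewrite -!mulrBr.
rewrite ler_wpM2l ?(ltW (product_law_gt0 _))//.
have := g0 x; rewrite le_eqVlt => /predU1P[<-|gx].
  by rewrite !mul0r sub0r oppr_le0 mulr_ge0// divr_ge0.
have [bx ax] := (gb x gx, ga' x gx); have bx' := ab' x ax.
have ratio : 0 < b x * (a' x / b' x) by rewrite mulr_gt0// divr_gt0.
apply: le_trans (xlnx_tangent (ltW gx) (ltW ratio) _) _ => //.
rewrite lnM ?ln_div ?posrE ?divr_gt0//.
by rewrite le_eqVlt; apply/orP; left; apply/eqP; ring.
Qed.

Lemma site_entropy_resample_same i g : ent i (resample i g) = 0.
Proof. by rewrite /ent resample_idem subrr. Qed.

(** * Chain rule for the entropy along the sites *)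

Definition resample_seq (s : seq 'I_n) g := foldr resample g s.

Lemma resample_seqC s i g :
  resample_seq s (resample i g) = resample i (resample_seq s g).
Proof. by elim: s => //= j s ->; rewrite resampleC. Qed.

Lemma resample_seq_ge0 s g : (forall x, 0 <= g x) ->
  forall x, 0 <= resample_seq s g x.
Proof. by move=> g0; elim: s => //= j s IH; exact: resample_ge0. Qed.

Lemma mean_resample_seq s g : mean (resample_seq s g) = mean g.
Proof. by elim: s => //= j s IH; rewrite mean_resample. Qed.

Lemma resample_seq_agree s g x y : (forall k, k \notin s -> x k = y k) ->
  resample_seq s g x = resample_seq s g y.
Proof.
elim: s x y => [|j s IH] x y xy /=.
  by congr g; apply/ffunP => k; exact: xy.
apply: eq_bigr => u _; congr (_ * _); apply: IH => k ks; rewrite !ffunE.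
by case: eqP => // /eqP kj; rewrite xy// inE negb_or kj.
Qed.

Lemma sum_product_law : \sum_(x : conf) pi x = 1.
Proof.
rewrite -(bigA_distr_bigA (fun _ : 'I_n => nu))/= big1// => i _.
exact: (proj2 nu_law).
Qed.

Lemma resample_seq_all g x : resample_seq (enum 'I_n) g x = mean g.
Proof.
rewrite -(mean_resample_seq (enum 'I_n)).
rewrite (eq_bigr (fun y => pi y * resample_seq (enum 'I_n) g x)).
  by rewrite -mulr_suml sum_product_law mul1r.
move=> y _; congr (_ * _); apply: resample_seq_agree => k.
by rewrite mem_enum.
Qed.

(** Resampling the sites after [i] integrates them out; what is left is the contribution of
    coordinate [i] given the earlier ones. *)
Definition entropy_incr i g := ent i (resample_seq (drop i.+1 (enum 'I_n)) g).
Local Notation delta := entropy_incr.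

Lemma entropy_incr_resample i j g : (forall x, 0 <= g x) ->
  delta i (resample j g) <= delta i g.
Proof.
by move=> g0; rewrite /delta resample_seqC site_entropy_resample//;
  exact: resample_seq_ge0.
Qed.

Lemma entropy_incr_resample_same i g : delta i (resample i g) = 0.
Proof. by rewrite /delta resample_seqC site_entropy_resample_same. Qed.

(** Resampling [i] itself does not raise the increment and brings it to 0. *)
Lemma entropy_incr_ge0 i g : (forall x, 0 <= g x) -> 0 <= delta i g.
Proof.
by move=> g0; rewrite -(entropy_incr_resample_same i g) entropy_incr_resample.
Qed.

Lemma sum_entropy_incr g : mean g = 1 -> \sum_i delta i g = phi g.
Proof.
(* [T k] is the entropy of the marginal on the first [k] coordinates, so the sum telescopes; [T 0]
   vanishes because full resampling gives the constant [mean g = 1]. *)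
move=> g1; pose T k := phi (resample_seq (drop k (enum 'I_n)) g).
rewrite (eq_bigr (fun i : 'I_n => T i.+1 - T i)) => [|i _].
  rewrite -(big_mkord xpredT (fun k => T k.+1 - T k)) telescope_sumr// /T.
  rewrite drop_oversize ?size_enum_ord// drop0 /=.
  rewrite (_ : resample_seq _ g = fun=> 1); last first.
    by apply/funext => x; rewrite resample_seq_all.
  rewrite [X in _ - X]/phi big1 ?subr0// => x _.
  by rewrite ln1 !mulr0.
rewrite /delta /ent /T (@drop_nth _ i i (enum _)) ?size_enum_ord//.
by rewrite nth_ord_enum.
Qed.

(** * Relabelling of the sites, and Jensen's inequality *)

Definition permute (sg : {perm 'I_n}) x : conf := [ffun k => x (sg k)].

Lemma permute_inj sg : injective (permute sg).
Proof.
move=> x y /ffunP xy; apply/ffunP => k.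
by have := xy ((sg^-1)%g k); rewrite !ffunE permKV.
Qed.

Lemma product_law_permute sg x : pi (permute sg x) = pi x.
Proof.
rewrite /product_law [RHS](reindex_inj (@perm_inj _ sg)).
by apply: eq_bigr => i _; rewrite ffunE.
Qed.

Lemma mean_permute sg g : mean (fun x => g (permute sg x)) = mean g.
Proof.
rewrite [RHS](reindex_inj (@permute_inj sg)).
by apply: eq_bigr => x _; rewrite product_law_permute.
Qed.

(** Coordinate [k] of [permute sg x] reads site [sg k] of [x]; swapping two sites sends this address
    to [tperm i j (sg k)]. *)
Lemma permute_swap sg x i j :
  permute sg (swap x i j) = permute (sg * tperm i j)%g x.
Proof. by apply/ffunP => k; rewrite !ffunE permM. Qed.

Lemma permute_replace sg x i s :
  permute sg (replace x i s) = replace (permute sg x) ((sg^-1)%g i) s.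
Proof.
apply/ffunP => k; rewrite !ffunE; congr (if _ then _ else _).
by apply/eqP/eqP => [<-|->]; rewrite ?permK ?permKV.
Qed.

(** Jensen's inequality, pointwise in [x]: in the tangent inequality at the average [y], the linear
    terms [G e x - y] average to zero. *)
Lemma xlnx_mean_convex (I : finType) (q : I -> R) (G : I -> conf -> R) :
  (forall e, 0 <= q e) -> \sum_e q e = 1 -> (forall e x, 0 <= G e x) ->
  phi (fun x => \sum_e q e * G e x) <= \sum_e q e * phi (G e).
Proof.
move=> q0 q1 G0; rewrite (eq_bigr (fun e => \sum_x pi x *
    (q e * (G e x * ln (G e x))))) => [|e _]; last first.
  by rewrite mulr_sumr; apply: eq_bigr => x _; rewrite mulrCA.
rewrite exchange_big; apply: ler_sum => x _; rewrite -mulr_sumr.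
rewrite ler_wpM2l ?(ltW (product_law_gt0 _))//.
set y := \sum_e _.
have y0 : 0 <= y by apply: sumr_ge0 => e _; rewrite mulr_ge0.
rewrite -subr_ge0 {1}/y mulr_suml -sumrB.
have mean0 : \sum_e q e * (G e x - y) = 0.
  rewrite (eq_bigr (fun e => q e * G e x - q e * y)) => [|e _].
    by rewrite sumrB -mulr_suml q1 mul1r subrr.
  by rewrite mulrBr.
apply: (@le_trans _ _ (\sum_e q e * (G e x - y))); first by rewrite mean0.
apply: ler_sum => e _; rewrite -mulrA -!mulrBr.
have := q0 e; rewrite le_eqVlt => /predU1P[<-|qe]; first by rewrite !mul0r.
rewrite ler_pM2l//; apply: xlnx_tangent => // Ge.
rewrite /y (bigD1 e)//= ltr_pwDl ?mulr_gt0// sumr_ge0// => e' _.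
by rewrite mulr_ge0.
Qed.

End Resampling.

(** * The Colored Exclusion Process *)

(** Symmetry of one Euler step passes to its powers; tested on indicators it is detailed balance,
    which survives the limit. *)
Lemma exp_mx_reversible (R : realType) (E : finType) (A : (E -> R) -> E -> R)
    (p : E -> R) (t : R) (x y : E) : linear_op A -> 0 <= t ->
  (forall eps f g, \sum_z p z * (euler_step A eps f z * g z) =
                   \sum_z p z * (f z * euler_step A eps g z)) ->
  p x * exp_mx t A x y = p y * exp_mx t A y x.
Proof.
move=> A_lin t0 A_sym.
have iter_sym eps k f g :
    \sum_z p z * (iter k (euler_step A eps) f z * g z) =
    \sum_z p z * (f z * iter k (euler_step A eps) g z).
  by elim: k f g => [//|k IH] f g; rewrite iterS A_sym IH -iterSr.
have sum_indic (h : E -> R) w : \sum_z h z * (z == w)%:R = h w.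
  rewrite (bigD1 w)//= eqxx mulr1 big1 ?addr0// => z /negPf ->.
  by rewrite mulr0.
have cv u w : p u * iter m (euler_step A (t / m%:R)) (fun z => (z == w)%:R) u
    @[m --> \oo] --> p u * exp_mx t A u w.
  rewrite -[exp_mx _ _ _ _](sum_indic (exp_mx t A u)).
  by apply: cvgMr; exact: cvg_euler.
apply: cvg_unique (cv x y) _ => //.
rewrite (_ : (fun m : nat => _) = fun m : nat => p y *
  iter m (euler_step A (t / m%:R)) (fun z => (z == x)%:R) y); first exact: cv.
apply/funext => m; set B := euler_step A _.
transitivity (\sum_z p z * (iter m B (fun z => (z == y)%:R) z * (z == x)%:R)).
  by under eq_bigr do rewrite mulrA; rewrite sum_indic.
rewrite iter_sym.
under eq_bigr do rewrite mulrCA mulrC.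
by rewrite sum_indic.
Qed.

Lemma big_option (R : nmodType) (T : finType) (F : option T -> R) :
  \sum_y F y = F None + \sum_x F (Some x).
Proof.
rewrite (bigD1 None)//=; congr (_ + _).
rewrite (reindex_omap Some id) => [|[]//].
by apply: eq_bigl => x; rewrite eqxx.
Qed.

Section ColoredExclusionEntropy.
Variables (R : realType) (S : finType) (n : nat) (nu : S -> R).
Variables (c : 'I_n -> 'I_n -> R) (r : 'I_n -> R).
Hypotheses (nu_law : is_law nu) (nu_full : forall s : S, 0 < nu s).
Hypothesis c_ge0 : forall i j : 'I_n, i != j -> 0 <= c i j.
Hypothesis c_sym : forall i j : 'I_n, i != j -> c i j = c j i.
Hypothesis r_ge0 : forall i : 'I_n, 0 <= r i.

Local Notation conf := {ffun 'I_n -> S}.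
Local Notation pi := (product_law nu).
Local Notation mean g := (\sum_(x : conf) pi x * g x).
Local Notation L := (CEP_generator nu c r).
Local Notation G := (jump_generator (killed_rates c r)).
Local Notation event := (unit + ('I_n * 'I_n + 'I_n))%type.

(** * One Euler step as an average over random events *)

Definition total_rate : R :=
  \sum_(i < n) \sum_(j < n | (i < j)%N) c i j + \sum_(i < n) r i.

(** Law of the event in a step of length [eps]: nothing, a swap, or a resampling. An unordered pair
    is encoded with [a < b], and the other pairs get weight 0. *)
Definition event_weight (eps : R) (e : event) : R :=
  match e with
  | inl _ => 1 - eps * total_rate
  | inr (inl (a, b)) => if (a < b)%N then eps * c a b else 0
  | inr (inr a) => eps * r a
  end.

Definition event_op (e : event) (g : conf -> R) (x : conf) : R :=
  match e with
  | inl _ => g x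
  | inr (inl (a, b)) => g (swap x a b)
  | inr (inr a) => resample nu a g x
  end.

(** Destination of a token at [l]: a swap may move it, and resampling its site kills it. *)
Definition event_site (e : event) (l : 'I_n) : option 'I_n :=
  match e with
  | inl _ => Some l
  | inr (inl (a, b)) => Some (tperm a b l)
  | inr (inr a) => if l == a then None else Some l
  end.

(** The exclusion process and the killed walk are averages over the same events; this puts either
    average in generator form. *)
Lemma sum_event_weight eps (h : event -> R) :
  \sum_e event_weight eps e * h e = h (inl tt) + eps *
   (\sum_(i < n) \sum_(j < n | (i < j)%N)
      c i j * (h (inr (inl (i, j))) - h (inl tt))
    + \sum_(i < n) r i * (h (inr (inr i)) - h (inl tt))).
Proof.
rewrite !big_sumType/= (bigD1 tt)//= big1 ?addr0 => [|[]//].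
rewrite (eq_bigr (fun p : 'I_n * 'I_n =>
  (if (p.1 < p.2)%N then eps * c p.1 p.2 else 0) *
  h (inr (inl (p.1, p.2))))) => [|[]//].
rewrite -(pair_bigA _ (fun a b : 'I_n =>
  (if (a < b)%N then eps * c a b else 0) * h (inr (inl (a, b)))))/=.
have -> : \sum_(i < n) \sum_(j < n | (i < j)%N)
    c i j * (h (inr (inl (i, j))) - h (inl tt)) =
    \sum_(i < n) \sum_(j < n | (i < j)%N) c i j * h (inr (inl (i, j))) -
    (\sum_(i < n) \sum_(j < n | (i < j)%N) c i j) * h (inl tt).
  rewrite mulr_suml -sumrB; apply: eq_bigr => i _.
  by rewrite mulr_suml -sumrB; apply: eq_bigr => j _; rewrite mulrBr.
have -> : \sum_(i < n) r i * (h (inr (inr i)) - h (inl tt)) =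
    \sum_(i < n) r i * h (inr (inr i)) - (\sum_(i < n) r i) * h (inl tt).
  by rewrite mulr_suml -sumrB; apply: eq_bigr => i _; rewrite mulrBr.
have -> : \sum_(i < n) \sum_(j < n) (if (i < j)%N then eps * c i j else 0) *
      h (inr (inl (i, j))) =
    eps * \sum_(i < n) \sum_(j < n | (i < j)%N) c i j * h (inr (inl (i, j))).
  rewrite mulr_sumr; apply: eq_bigr => i _.
  rewrite mulr_sumr [RHS]big_mkcond; apply: eq_bigr => j _.
  by case: ifP => _; rewrite ?mul0r// mulrA.
have -> : \sum_(i < n) eps * r i * h (inr (inr i)) =
    eps * \sum_(i < n) r i * h (inr (inr i)).
  by rewrite mulr_sumr; apply: eq_bigr => i _; rewrite mulrA.
rewrite /total_rate; ring.
Qed.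

Lemma event_weight_sum1 eps : \sum_e event_weight eps e = 1.
Proof.
have := sum_event_weight eps (fun=> 1).
under eq_bigr do rewrite mulr1.
move=> ->; rewrite [X in _ * (X + _)]big1 => [|i _].
  by rewrite big1 ?addr0 ?mulr0 ?addr0// => i _; rewrite subrr mulr0.
by rewrite big1// => j _; rewrite subrr mulr0.
Qed.

Lemma event_weight_ge0 eps e : 0 <= eps -> eps * total_rate <= 1 ->
  0 <= event_weight eps e.
Proof.
move=> e0 e1; case: e => [_|[[a b]|a]] /=; first by rewrite subr_ge0.
  case: ifP => // ab; rewrite mulr_ge0// c_ge0//.
  by apply: contraTN ab => /eqP ->; rewrite ltnn.
by rewrite mulr_ge0.
Qed.

Lemma CEP_euler_events eps g x :
  euler_step L eps g x = \sum_e event_weight eps e * event_op e g x.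
Proof.
rewrite (sum_event_weight eps (fun e => event_op e g x)) /euler_step/=.
congr (_ + _ * (_ + _)); apply: eq_bigr => i _; congr (_ * _).
rewrite /resample; under eq_bigr do rewrite mulrBr.
by rewrite sumrB -mulr_suml (proj2 nu_law) mul1r.
Qed.

Lemma event_op_ge0 e g : (forall x, 0 <= g x) -> forall x, 0 <= event_op e g x.
Proof. by move=> g0 x; case: e => [_|[[a b]|a]] //=; apply: resample_ge0. Qed.

Lemma CEP_linear : linear_op L.
Proof.
(* At [eps = 1], [L] is the event sum minus the identity; the weights may be negative, but linearity
   is insensitive to sign. *)
have LE f x : L f x = \sum_e event_weight 1 e * event_op e f x - f x.
  by rewrite -CEP_euler_events /euler_step; ring.
move=> a f g x; rewrite !LE.
have -> : \sum_e event_weight 1 e * event_op e (fun z => a * f z + g z) x =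
    a * (\sum_e event_weight 1 e * event_op e f x) +
    \sum_e event_weight 1 e * event_op e g x.
  rewrite mulr_sumr -big_split/=; apply: eq_bigr => e _.
  have -> : event_op e (fun z => a * f z + g z) x =
      a * event_op e f x + event_op e g x; last by ring.
  case: e => [_|[[i j]|i]] //=; rewrite /resample mulr_sumr -big_split/=.
  by apply: eq_bigr => s _; ring.
ring.
Qed.

(** Each event is self-adjoint for [pi]: a swap is a measure-preserving involution, a resampling a
    conditional expectation. *)
Lemma CEP_euler_symmetric eps f g :
  mean (fun x => euler_step L eps f x * g x) =
  mean (fun x => f x * euler_step L eps g x).
Proof.
rewrite (eq_bigr (fun x => \sum_e event_weight eps e *
   (pi x * (event_op e f x * g x)))) => [|x _]; last first.
  rewrite CEP_euler_events mulr_suml mulr_sumr.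
  by apply: eq_bigr => e _; ring.
rewrite [RHS](eq_bigr (fun x => \sum_e event_weight eps e *
   (pi x * (f x * event_op e g x)))) => [|x _]; last first.
  rewrite CEP_euler_events mulr_sumr mulr_sumr.
  by apply: eq_bigr => e _; ring.
rewrite exchange_big [RHS]exchange_big/=; apply: eq_bigr => e _.
rewrite -!mulr_sumr; congr (_ * _); case: e => [_|[[i j]|i]] //=.
  rewrite -(mean_permute nu (tperm i j)); apply: eq_bigr => x _.
  congr (_ * (f _ * _)); apply/ffunP => k; rewrite !ffunE ?tpermK//.
exact: mean_resampleM.
Qed.

(** * The discretized killed walk as the motion of a token *)

Lemma jump_generator_linear (E : finType) (q : E -> E -> R) :
  linear_op (jump_generator q).
Proof.
move=> a f g x; rewrite /jump_generator mulr_sumr -big_split/=.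
by apply: eq_bigr => y _; ring.
Qed.

(** A transposition displaces [l] only if [l] is one of its two sites, and then sends it to the
    other one. *)
Lemma sum_swap_site (u : 'I_n -> R) l :
  \sum_(i < n) \sum_(j < n | (i < j)%N) c i j * (u (tperm i j l) - u l) =
  \sum_(j < n) c l j * (u j - u l).
Proof.
(* [a] collects the partners above [l] and [b] those below; symmetry of [c] turns the latter into
   jumps out of [l]. *)
pose a (j : 'I_n) := if (l < j)%N then c l j * (u j - u l) else 0.
pose b (i : 'I_n) := if (i < l)%N then c i l * (u i - u l) else 0.
transitivity (\sum_j a j + \sum_i b i); last first.
  rewrite -big_split/=; apply: eq_bigr => j _; rewrite /a /b.
  have [lj|jl|/val_inj ->] := ltngtP l j; rewrite ?addr0 ?add0r ?subrr ?mulr0//.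
  by rewrite c_sym// neq_ltn jl.
transitivity (\sum_i ((if i == l then \sum_j a j else 0) + b i)); last first.
  by rewrite big_split/= -big_mkcond/= big_pred1_eq.
apply: eq_bigr => i _; case: (eqVneq i l) => [->|il].
  rewrite /b ltnn addr0 big_mkcond; apply: eq_bigr => j _.
  by rewrite tpermL.
rewrite add0r /b; case: ifP => il'; last first.
  rewrite big1// => j ij; rewrite tpermD ?subrr ?mulr0//.
  by apply: contraFN il' => /eqP <-.
rewrite (bigD1 l)//= tpermR big1 ?addr0// => j /andP[_ jl].
by rewrite tpermD ?subrr ?mulr0.
Qed.

Lemma killed_euler_events eps (v : option 'I_n -> R) l : v None = 0 ->
  euler_step G eps v (Some l) = \sum_e event_weight eps e *
    (if event_site e l is Some k then v (Some k) else 0).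
Proof.
move=> v0; rewrite sum_event_weight /euler_step/=; congr (_ + _ * _).
rewrite /jump_generator big_option/= v0 addrC; congr (_ + _).
  by rewrite (sum_swap_site (fun k => v (Some k))).
rewrite (bigD1 l)//= eqxx big1 ?addr0// => i; rewrite eq_sym => /negPf ->.
by rewrite subrr mulr0.
Qed.

(** For small [eps], the probability that the discretized walk is still alive after [k] steps. *)
Definition survival (eps : R) (k : nat) : option 'I_n -> R :=
  iter k (euler_step G eps) (fun y => (y != None)%:R).

Lemma survival_None eps k : survival eps k None = 0.
Proof.
elim: k => [//|k IH]; rewrite /survival iterS /euler_step -/(survival _ _) IH.
by rewrite /jump_generator big1 ?mulr0 ?addr0// => y _; rewrite mul0r.
Qed.

Lemma survivalS eps k l : survival eps k.+1 (Some l) =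
  \sum_e event_weight eps e * survival eps k (event_site e l).
Proof.
rewrite /survival iterS -/(survival eps k) killed_euler_events ?survival_None//.
apply: eq_bigr => e _; congr (_ * _).
by case: (event_site e l) => //; rewrite survival_None.
Qed.

Section Step.
Variable eps : R.
Hypotheses (eps_ge0 : 0 <= eps) (eps_le : eps * total_rate <= 1).

Lemma survival_ge0 k y : 0 <= survival eps k y.
Proof.
elim: k y => [y|k IH [l|]]; [by rewrite ler0n| |by rewrite survival_None].
by rewrite survivalS sumr_ge0// => e _; rewrite mulr_ge0 ?event_weight_ge0.
Qed.

Lemma CEP_iter_ge0 k g : (forall x, 0 <= g x) ->
  forall x, 0 <= iter k (euler_step L eps) g x.
Proof.
move=> g0; elim: k => [//|k IH] x; rewrite iterS CEP_euler_events.
apply: sumr_ge0 => e _; rewrite mulr_ge0 ?event_weight_ge0//.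
exact: event_op_ge0.
Qed.

(* The token of coordinate i of g sits at site sg i: a swap moves it, while
   resampling its site erases it, i.e. cancels its entropy increment. *)
Lemma xlnx_mean_CEP_iter k g (sg : {perm 'I_n}) :
  (forall x, 0 <= g x) -> mean g = 1 ->
  xlnx_mean nu (iter k (euler_step L eps) (fun x => g (permute sg x))) <=
  \sum_i entropy_incr nu i g * survival eps k (Some (sg i)).
Proof.
elim: k g sg => [|k IH] g sg g0 g1.
  rewrite (eq_bigr (entropy_incr nu ^~ g)) => [|i _]; last by rewrite mulr1.
  rewrite (sum_entropy_incr nu_law g1)/=.
  by rewrite /xlnx_mean (mean_permute nu sg (fun x => g x * ln (g x))).
pose gs x := g (permute sg x).
(* The step acting first on [gs] is split into events; by linearity the other [k] steps act on each
   piece, which prepares Jensen's inequality. *)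
have -> : iter k.+1 (euler_step L eps) gs = fun x => \sum_e
    event_weight eps e * iter k (euler_step L eps) (event_op e gs) x.
  apply/funext => x; rewrite iterSr -(linear_op_sum
    (linear_op_iter (linear_op_euler CEP_linear eps) k)).
  by congr (iter _ _ _ _); apply/funext => z; rewrite CEP_euler_events.
apply: le_trans (xlnx_mean_convex nu_full
  (fun e => event_weight_ge0 e eps_ge0 eps_le)
  (event_weight_sum1 eps) _) _.
  by move=> e; apply: CEP_iter_ge0; apply: event_op_ge0 => x; exact: g0.
under [leRHS]eq_bigr do rewrite survivalS mulr_sumr.
rewrite exchange_big/=; apply: ler_sum => e _.
under [leRHS]eq_bigr do rewrite mulrCA.
rewrite -mulr_sumr ler_wpM2l ?event_weight_ge0//.
case: e => [[]|[[a b]|a]] /=; first exact: IH.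
  have -> : event_op (inr (inl (a, b))) gs =
      fun x => g (permute (sg * tperm a b)%g x).
    by apply/funext => x; rewrite /= /gs permute_swap.
  apply: le_trans (IH _ _ g0 g1) _.
  by apply: ler_sum => i _; rewrite permM.
(* Site [a] carries coordinate [sg^-1 a] of [g]: that coordinate is resampled and [sg] is
   unchanged. *)
have -> : event_op (inr (inr a)) gs =
    fun x => resample nu ((sg^-1)%g a) g (permute sg x).
  apply/funext => x; apply: eq_bigr => s _.
  by rewrite /gs permute_replace.
apply: le_trans (IH _ _ (resample_ge0 nu_full _ g0) _) _.
  by rewrite mean_resample.
(* The killed token has a zero increment; the other increments do not grow. *)
apply: ler_sum => i _; case: eqP => [<-|_].
  by rewrite permK entropy_incr_resample_same// mul0r mulr_ge0
    ?entropy_incr_ge0 ?survival_ge0.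
by rewrite ler_wpM2r ?survival_ge0// entropy_incr_resample.
Qed.

End Step.

(** * Passage to continuous time *)

Lemma cvg_CEP t f x : 0 <= t ->
  iter m (euler_step L (t / m%:R)) f x @[m --> \oo] -->
  \sum_y exp_mx t L x y * f y.
Proof. exact: (cvg_euler CEP_linear). Qed.

Lemma cvg_survival t l : 0 <= t ->
  survival (t / m%:R) m (Some l) @[m --> \oo] -->
  \sum_j exp_mx t G (Some l) (Some j).
Proof.
move=> t0; rewrite (_ : \sum_j _ =
    \sum_y exp_mx t G (Some l) y * (y != None)%:R); last first.
  by rewrite big_option mulr0 add0r; apply: eq_bigr => j _; rewrite mulr1.
exact: (cvg_euler (jump_generator_linear _)).
Qed.

Lemma euler_mesh_small t : 0 <= t -> \forall m \near \oo,
  0 <= t / m%:R :> R /\ t / m%:R * total_rate <= 1.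
Proof.
move=> t0; near=> m.
have m0 : 0 < m%:R :> R by rewrite ltr0n; near: m; exact: nbhs_infty_gt.
split; first by rewrite divr_ge0.
rewrite mulrAC ler_pdivrMr// mul1r; near: m; exact: nbhs_infty_ger.
Unshelve. all: by end_near. Qed.

Lemma xlnx_mean_CEP t f : 0 <= t -> (forall x, 0 <= f x) -> mean f = 1 ->
  xlnx_mean nu (fun x => \sum_y exp_mx t L x y * f y) <=
  \sum_i entropy_incr nu i f * \sum_j exp_mx t G (Some i) (Some j).
Proof.
move=> t0 f0 f1; set F := fun x => _; set B := \sum_i _.
pose Fm m := iter m (euler_step L (t / m%:R)) f.
have FmF x : Fm m x @[m --> \oo] --> F x by exact: cvg_CEP.
have F0 x : 0 <= F x.
  apply: (ler_cvg_to (cvg_cst 0) (FmF x)).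
  by apply: filterS (euler_mesh_small t0) => m [? ?]; exact: CEP_iter_ge0.
(* Lower semicontinuity of the entropy, as a supremum of affine functionals. *)
have affine_bound (y : conf -> R) : (forall x, 0 < y x) ->
    mean (fun x => F x * ln (y x) + (F x - y x)) <= B.
  move=> y0.
  have cvl : mean (fun x => Fm m x * ln (y x) + (Fm m x - y x)) @[m --> \oo]
      --> mean (fun x => F x * ln (y x) + (F x - y x)).
    apply: cvg_sumr => x; apply: cvgMr; apply: cvgD; first exact: cvgMl.
    by apply: cvgB => //; exact: cvg_cst.
  have cvr : \sum_i entropy_incr nu i f * survival (t / m%:R) m (Some i)
      @[m --> \oo] --> B.
    by apply: cvg_sumr => i; apply: cvgMr; exact: cvg_survival.
  apply: (ler_cvg_to cvl cvr).
  apply: filterS (euler_mesh_small t0) => m [e0 e1].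
  have Fm0 := CEP_iter_ge0 e0 e1 m f0.
  have permute1 x : permute 1%g x = x.
    by apply/ffunP => k; rewrite ffunE perm1.
  have := xlnx_mean_CEP_iter e0 e1 m 1%g f0 f1.
  rewrite (_ : (fun x => f (permute 1%g x)) = f); last first.
    by apply/funext => x; rewrite permute1.
  under [leRHS]eq_bigr do rewrite perm1.
  apply: le_trans; apply: ler_sum => x _.
  rewrite ler_wpM2l ?(ltW (product_law_gt0 nu_full _))//.
  have := xlnx_tangent (Fm0 x) (ltW (y0 x)) (fun=> y0 x).
  by rewrite mulrBr -/(Fm m) lerBrDl.
(* The best choice [y = F] may vanish; [F + eta] is positive and costs at most [eta]. *)
apply/ler_addgt0Pr => eta eta0; rewrite -lerBlDr.
apply: le_trans (affine_bound (fun x => F x + eta) _); last first.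
  by move=> x; rewrite ltr_wpDl.
have -> : xlnx_mean nu F - eta = mean (fun x => F x * ln (F x) - eta).
  rewrite -[X in _ - X = _]mul1r -(sum_product_law n nu_law) mulr_suml -sumrB.
  by apply: eq_bigr => x _; rewrite mulrBr.
apply: ler_sum => x _.
rewrite ler_wpM2l ?(ltW (product_law_gt0 nu_full _))//.
rewrite opprD addNKr lerD2r.
have := F0 x; rewrite le_eqVlt => /predU1P[<-|Fx]; first by rewrite !mul0r.
by rewrite ler_pM2l// ler_ln ?posrE ?ler_wpDr// ?ltr_wpDr// ltW.
Qed.

Lemma relative_entropy_density (mu : conf -> R) :
  relative_entropy mu pi = xlnx_mean nu (fun x => mu x / pi x).
Proof.
apply: eq_bigr => x _; rewrite mulrA; congr (_ * _).
by rewrite mulrCA divff ?mulr1// gt_eqF// product_law_gt0.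
Qed.

(** By reversibility, densities with respect to [pi] evolve under the semigroup itself. *)
Lemma mul_law_mx_density t (mu : conf -> R) x : 0 <= t ->
  mul_law_mx mu (exp_mx t L) x / pi x = \sum_y exp_mx t L x y * (mu y / pi y).
Proof.
move=> t0; rewrite /mul_law_mx mulr_suml; apply: eq_bigr => y _.
have := exp_mx_reversible x y CEP_linear t0 CEP_euler_symmetric.
have [px py] : pi x != 0 /\ pi y != 0 by rewrite !gt_eqF ?product_law_gt0.
by move=> e; rewrite -[exp_mx t L y x](mulKf py) -e; field; apply/andP.
Qed.

Lemma relative_entropy_CEP t (mu : conf -> R) (K : R) : is_law mu -> 0 <= t ->
  (forall i, \sum_j exp_mx t G (Some i) (Some j) <= K) ->
  relative_entropy (mul_law_mx mu (exp_mx t L)) pi <=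
  relative_entropy mu pi * K.
Proof.
move=> [mu0 mu1] t0 leK; rewrite !relative_entropy_density.
under [X in xlnx_mean _ X]eq_fun do rewrite mul_law_mx_density//.
set f := fun x => mu x / pi x.
have f0 x : 0 <= f x by rewrite divr_ge0// ltW// product_law_gt0.
have f1 : mean f = 1.
  rewrite -mu1; apply: eq_bigr => x _.
  by rewrite mulrCA divff ?mulr1// gt_eqF// product_law_gt0.
apply: le_trans (xlnx_mean_CEP t0 f0 f1) _.
(* The increments are nonnegative and sum to the initial entropy, so each survival factor may be
   replaced by [K]. *)
rewrite -(sum_entropy_incr nu_law f1) mulr_suml; apply: ler_sum => i _.
by rewrite ler_wpM2l// entropy_incr_ge0.
Qed.

End ColoredExclusionEntropy.

(** * The killed walk *)

Section Lifetime.
Variables (R : realType) (n : nat) (c : 'I_n -> 'I_n -> R) (r : 'I_n -> R).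
Variables (d : measure_display) (Omega : measurableType d).
Variables (P : probability Omega R) (i : 'I_n).
Variable X : R -> Omega -> option 'I_n.
Hypothesis X_walk : killed_random_walk c r P i X.

(** By right continuity, a walk alive at [t] stays put for a positive time, and by absorption it was
    not killed before; hence the strict inequality for the infimum. *)
Lemma lifetime_gt t : 0 <= t ->
  [set w | (t%:E < lifetime X w)%E] = [set w | X t w <> None].
Proof.
move=> t0; apply/seteqP; split => w /=.
  move=> tX Xt; have : (lifetime X w <= t%:E)%E.
    by apply: ereal_inf_lbound; exists t.
  by rewrite leNgt tX.
move=> Xt.
have /nbhs_ballP[e /= e0 rc] := krw_right_continuous X_walk w t0.
apply: (@lt_le_trans _ _ (t + e / 2)%:E).
  by rewrite lte_fin ltrDl divr_gt0.
apply: le_ereal_inf_tmp => _ [s [s0 Xs] <-]; rewrite lee_fin leNgt.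
apply/negP => ste; apply: Xt; have [ts|st] := ltP t s; last first.
  exact: (krw_absorbed X_walk s0 st).
rewrite -Xs; apply/esym/rc => //.
rewrite /ball/= distrC ger0_norm ?subr_ge0 ?(ltW ts)// ltrBlDl.
by apply: lt_trans ste _; rewrite ltrD2l ltr_pdivrMr// ltr_pMr// ltr1n.
Qed.

Lemma killed_walk_marginal t a : 0 <= t ->
  ((exp_mx t (jump_generator (killed_rates c r)) (Some i) a)%:E <=
   P [set w | X t w = a])%E.
Proof.
move=> t0.
have := krw_law X_walk 1%N (t := fun l => if l == 0%N then 0 else t)
  (a := fun l => if l == 0%N then Some i else a) erefl _ erefl.
rewrite big_ord1/= subr0 => <-; last by case.
set A := [set w | _].
have AE : A = [set w | X 0 w = Some i] `&` [set w | X t w = a].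
  apply/seteqP; split => w /=.
    by move=> Aw; split; [exact: (Aw 0%N)|exact: (Aw 1%N)].
  by move=> [X0 Xt] [|[|l]].
rewrite AE; apply: le_measure; rewrite ?inE; last by move=> w [].
- by apply: measurableI; exact: (krw_measurable X_walk).
- exact: (krw_measurable X_walk).
Qed.

(** Being alive at [t] splits into the disjoint events of sitting at each site. *)
Lemma survival_le_lifetime t : 0 <= t ->
  ((\sum_j exp_mx t (jump_generator (killed_rates c r)) (Some i) (Some j))%:E
   <= P [set w | (t%:E < lifetime X w)%E])%E.
Proof.
move=> t0; rewrite lifetime_gt//.
have -> : [set w | X t w <> None] =
    \big[setU/set0]_(j < n) [set w | X t w = Some j].
  rewrite -bigcup_seq; apply/seteqP; split => w /=.
    by case E : (X t w) => [j|//] _; exists j => //=; rewrite mem_index_enum.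
  by move=> [j _ /= ->].
rewrite measure_bigsetU_ord => [|j|].
- by rewrite -sumEFin; apply: lee_sum => j _; exact: killed_walk_marginal.
- exact: (krw_measurable X_walk).
- by move=> j k _ _ [w [/= -> []]].
Qed.

End Lifetime.

Theorem corollary3 (R : realType) (S : finType) (nu : S -> R)
  (n : nat) (c : 'I_n -> 'I_n -> R) (r : 'I_n -> R)
  (d : measure_display) (Omega : measurableType d)
  (Pr : 'I_n -> probability Omega R) (X : R -> Omega -> option 'I_n)
  (nu_law : is_law nu) (nu_full : forall s : S, 0 < nu s)
  (n_ge1 : (1 <= n)%N)
  (c_ge0 : forall i j : 'I_n, i != j -> 0 <= c i j)
  (c_sym : forall i j : 'I_n, i != j -> c i j = c j i)
  (r_ge0 : forall i : 'I_n, 0 <= r i)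
  (r_meets : forall i : 'I_n,
     exists2 j : 'I_n, connect (conductance_graph c) i j & r j != 0)
  (X_walk : forall i : 'I_n, killed_random_walk c r (Pr i) i X)
  (mu : {ffun 'I_n -> S} -> R) (mu_law : is_law mu)
  (t : R) (t_ge0 : 0 <= t) :
  ((relative_entropy (mul_law_mx mu (exp_mx t (CEP_generator nu c r)))
      (product_law nu))%:E
   <= (relative_entropy mu (product_law nu))%:E *
      \big[maxe/-oo]_(i < n) Pr i [set w | t%:E < lifetime X w])%E.
Proof.
set M := bigop _ _ _.
have M_ge i : (Pr i [set w | (t%:E < lifetime X w)%E] <= M)%E.
  exact: (le_bigmax _ (fun i => Pr i [set w | (t%:E < lifetime X w)%E])).
(* [n_ge1] supplies a site, so the maximum is not its default [-oo]; probabilities bound it by 1.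
   The product can then be computed in the reals. *)
have M_fin : M \is a fin_num.
  rewrite fin_numE; apply/andP; split.
    rewrite -ltNye; apply: lt_le_trans (M_ge (Ordinal n_ge1)).
    exact: lt_le_trans (ltNyr 0) _.
  rewrite -ltey; apply: (@le_lt_trans _ _ 1%E); last exact: ltry.
  apply: bigmax_le; first exact: leNye.
  move=> i _; apply: probability_le1.
  rewrite (lifetime_gt (X_walk i) t_ge0).
  have -> : [set w | X t w <> None] = ~` [set w | X t w = None] by [].
  by apply: measurableC; exact: (krw_measurable (X_walk i)).
rewrite -(fineK M_fin) -EFinM lee_fin.
apply: relative_entropy_CEP => // i.
rewrite -lee_fin fineK//; apply: le_trans (M_ge i).
exact: survival_le_lifetime.
Qed.
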